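(* Let $G$ be a finite group and let $N\unlhd G$ be such that $|G:N|=p$ for some prime number $p$. Then $$M_{G,N}'=-\sum_{C\leq N,\ C\text{ is cyclic}}\varphi(|C|)-\sum_{Y\lneq G,\ Y\nleq N}M'_{Y,\,Y\cap N},$$ where the first sum runs over all cyclic subgroups $C$ of $N$ (including the trivial one), the second over all proper subgroups $Y$ of $G$ not contained in $N$, and $\varphi$ is the Euler totient function.
   Context: For a finite group $G$, $\mu$ denotes the Möbius function of the poset of all subgroups of $G$ ordered by inclusion (that is, the matrix $(\mu(K,D))_{K,D\leq G}$ is the inverse of the matrix $(\zeta(K,D))_{K,D\le G}$, where $\zeta(K,D)=1$ if $K\leq D$ and $0$ otherwise). For a finite group $H$ and a normal subgroup $L\unlhd H$ of prime index, set $$M'_{H,L}:=\sum_{X\leq L}|X|\,\mu(X,H),$$ the sum running over all subgroups $X$ of $L$. If $Y\leq G$ and $Y\nleq N$, with $|G:N|=p$, then $YN=G$ and $Y\cap N$ is normal of index $p$ in $Y$, so $M'_{Y,Y\cap N}$ is defined. *)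

(* Defs.v *)
From mathcomp Require Import all_boot all_order all_algebra.
From mathcomp Require Import all_fingroup all_solvable.

Set Implicit Arguments.
Unset Strict Implicit.
Unset Printing Implicit Defensive.

Import GRing.Theory.
Local Open Scope ring_scope.

Definition nth_subgroup (gT : finGroupType) (G : {group gT})
    (i : 'I_#|subgroups G|) : {group gT} := enum_val i.

Definition zeta_mx (gT : finGroupType) (G : {group gT}) :
    'M[int]_#|subgroups G| :=
  \matrix_(i, j) (nth_subgroup i \subset nth_subgroup j)%:R.

(* A permutation contributing to the determinant sends each subgroup to an
   overgroup; comparing the sums of the orders, it is the identity. *)
Lemma det_zeta_mx (gT : finGroupType) (G : {group gT}) :
  \det (zeta_mx G) = 1.
Proof.
rewrite /determinant (bigD1 1%g) //= odd_perm1 expr0 mul1r.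
have ->: \prod_i zeta_mx G i ((1%g : 'S__) i) = 1.
  by apply: big1 => i _; rewrite mxE perm1 subxx.
rewrite [X in _ + X]big1 ?addr0 // => s; apply: contraNeq => nz_s; apply/eqP.
have sub_s i : nth_subgroup i \subset nth_subgroup (s i).
  apply: (contraR _ nz_s) => nsub.
  by rewrite (bigD1 i) //= mxE (negPf nsub) mul0r mulr0.
have eq_sum : (\sum_(i < #|subgroups G|) #|nth_subgroup i| =
               \sum_i #|nth_subgroup (s i)|)%N.
  exact: reindex_inj (@perm_inj _ s).
have le_s i : (#|nth_subgroup i| <= #|nth_subgroup (s i)| ?= iff
                 (#|nth_subgroup i| == #|nth_subgroup (s i)|))%N.
  by split; first exact/subset_leq_card/sub_s.
have [_] := leqif_sum (fun i (_ : true) => le_s i).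
rewrite eq_sum eqxx => /esym/forallP eq_s.
apply/permP => i; rewrite perm1; apply/esym/enum_val_inj/val_inj/eqP.
by rewrite eqEcard sub_s /= (eqP (eq_s i)).
Qed.

Lemma zeta_mx_unit (gT : finGroupType) (G : {group gT}) :
  zeta_mx G \in unitmx.
Proof. by rewrite unitmxE det_zeta_mx unitr1. Qed.

Lemma trivg_in_subgroups (gT : finGroupType) (G : {group gT}) :
  1%G \in subgroups G.
Proof. by rewrite inE sub1G. Qed.

(* Only meaningful for K and D subgroups of G: enum_rank_in sends any other
   subgroup to the index of the trivial one. *)
Definition mobius (gT : finGroupType) (G K D : {group gT}) : int :=
  invmx (zeta_mx G) (enum_rank_in (trivg_in_subgroups G) K)
                    (enum_rank_in (trivg_in_subgroups G) D).

(* Intended for L normal of prime index in H, although the formula does not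
   use it. *)
Definition Mprime (gT : finGroupType) (H L : {group gT}) : int :=
  \sum_(X : {group gT} | X \subset L) #|X|%:Z * mobius H X H.

(* Main.v *)
Require Import Defs.
From mathcomp Require Import all_boot all_order all_algebra.
From mathcomp Require Import all_fingroup all_solvable.

Set Implicit Arguments.
Unset Strict Implicit.
Unset Printing Implicit Defensive.

Import GRing.Theory.
Local Open Scope ring_scope.

(** Adding the term Y = G to the right-hand side, the sum of M'_{Y, Y ∩ N} over
    all Y <= G with Y not in N is, after exchanging sums, the sum over X <= N
    of |X| times the sum of mu(X, Y) over those Y. The sum of mu(X, Y) over
    all Y <= G is [X = G] = 0, and over all Y <= N it is [X = N], so only
    - |N| remains. Partitioning N by generated cyclic subgroups writes |N| as
    a sum of totients. *)

Section Mobius.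

Variable gT : finGroupType.
Implicit Types G H K D X Y C : {group gT}.

Lemma nth_subgroup_rank G K :
    K \subset G ->
  nth_subgroup (enum_rank_in (trivg_in_subgroups G) K) = K.
Proof. by move=> sKG; rewrite /nth_subgroup enum_rankK_in ?inE. Qed.

Lemma eq_rank_subgroup G K D :
    K \subset G -> D \subset G ->
  (enum_rank_in (trivg_in_subgroups G) K
     == enum_rank_in (trivg_in_subgroups G) D) = (K == D).
Proof.
move=> sKG sDG; apply/eqP/eqP => [/(congr1 (@nth_subgroup _ G))|-> //].
by rewrite !nth_subgroup_rank.
Qed.

Lemma sum_nth_subgroup G (F : {group gT} -> int) :
  \sum_(i < #|subgroups G|) F (nth_subgroup i)
    = \sum_(X : {group gT} | X \subset G) F X.
Proof.
transitivity (\sum_(X in subgroups G) F X); first by rewrite [RHS]big_enum_val.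
by apply: eq_bigl => X; rewrite inE.
Qed.

Lemma mobius_nth G (i j : 'I_#|subgroups G|) :
  mobius G (nth_subgroup i) (nth_subgroup j) = invmx (zeta_mx G) i j.
Proof. by rewrite /mobius !enum_valK_in. Qed.

(** This is the (K, D) entry of the product of [zeta_mx G] with its inverse; the opposite order of
    the factors gives [sum_mobius_below]. *)
Lemma sum_mobius_above G K D :
    K \subset G -> D \subset G ->
  \sum_(X : {group gT} | (X \subset G) && (K \subset X)) mobius G X D
    = (K == D)%:R.
Proof.
move=> sKG sDG; set rk := enum_rank_in (trivg_in_subgroups G).
have := congr1 (fun A : 'M_ _ => A (rk K) (rk D)) (mulmxV (zeta_mx_unit G)).
rewrite !mxE eq_rank_subgroup // => <-.
rewrite big_mkcondr -sum_nth_subgroup; apply: eq_bigr => i _.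
rewrite mxE nth_subgroup_rank // -mobius_nth.
by rewrite nth_subgroup_rank //; case: ifP; rewrite (mul1r, mul0r).
Qed.

Lemma sum_mobius_below G K D :
    K \subset G -> D \subset G ->
  \sum_(X : {group gT} | (X \subset G) && (X \subset D)) mobius G K X
    = (K == D)%:R.
Proof.
move=> sKG sDG; set rk := enum_rank_in (trivg_in_subgroups G).
have := congr1 (fun A : 'M_ _ => A (rk K) (rk D)) (mulVmx (zeta_mx_unit G)).
rewrite !mxE eq_rank_subgroup // => <-.
rewrite big_mkcondr -sum_nth_subgroup; apply: eq_bigr => i _.
rewrite [zeta_mx _ _ _]mxE [nth_subgroup (rk D)]nth_subgroup_rank //.
rewrite -mobius_nth nth_subgroup_rank //.
by case: ifP; rewrite (mulr1, mulr0).
Qed.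

(** Induction on |G| - |K|: [f] vanishes on every X strictly above K, so the sum over the overgroups
    of K reduces to [f K]. This is the uniqueness half of Möbius inversion. *)
Lemma eq0_of_sums_above G (f : {group gT} -> int) K :
    K \subset G ->
    (forall H, K \subset H -> H \subset G ->
       \sum_(X : {group gT} | (X \subset G) && (H \subset X)) f X = 0) ->
  f K = 0.
Proof.
have [n] := ubnP (#|G| - #|K|)%N; elim: n K => // n IHn K leGKn sKG sum0.
have := sum0 K (subxx K) sKG.
rewrite (bigD1 K) ?sKG ?subxx //= big1 ?addr0 // => X.
case/andP=> /andP[sXG sKX] neXK; apply: IHn => // [|H sXH sHG].
  have ltKX : (#|K| < #|X|)%N.
    by apply: proper_card; rewrite properEneq eq_sym neXK.
  by apply: leq_trans (_ : #|G| - #|K| <= n)%N => //;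
     apply: ltn_sub2l => //; apply: leq_trans ltKX (subset_leq_card sXG).
exact: sum0 (subset_trans sKX sXH) sHG.
Qed.

(** For H above K, the sum of mu(X, D) over X above H is [H = D], and H = D would put K inside D. *)
Lemma mobius_eq0 G K D :
  K \subset G -> D \subset G -> ~~ (K \subset D) -> mobius G K D = 0.
Proof.
move=> sKG sDG nsKD.
apply: (@eq0_of_sums_above G (fun X => mobius G X D)) => // H sKH sHG.
rewrite sum_mobius_above //; case: eqP => // eqHD.
by rewrite -eqHD sKH in nsKD.
Qed.

(** Each [Mprime Y] uses the Möbius function of its own group Y, and exchanging sums requires a
    common one. Both sides have the same sums over overgroups inside H, because mu(X, H) computed in
    G vanishes for X outside H. *)
Lemma mobius_restrict G H K :
  H \subset G -> K \subset H -> mobius H K H = mobius G K H.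
Proof.
move=> sHG sKH; apply/eqP; rewrite -subr_eq0; apply/eqP.
apply: (@eq0_of_sums_above H (fun X => mobius H X H - mobius G X H)) => //.
move=> Y sKY sYH; have sYG := subset_trans sYH sHG.
apply/eqP; rewrite sumrB subr_eq0 sum_mobius_above //.
rewrite -(sum_mobius_above sYG sHG); apply/eqP.
rewrite [LHS](bigID (fun X : {group gT} => X \subset H)) /=.
rewrite [X in _ + X]big1 ?addr0 => [|X]; last first.
  by case/andP=> /andP[sXG _]; apply: mobius_eq0.
apply: eq_bigl => X; rewrite andbC.
by case: (boolP (X \subset H)) => //= sXH; rewrite (subset_trans sXH sHG).
Qed.

(** Group the elements of G by the cyclic subgroup they generate: the fibre over C consists of its
    generators. *)
Lemma sum_totient_cyclic G :
  (\sum_(C : {group gT} | (C \subset G) && cyclic C) totient #|C|)%N = #|G|.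
Proof.
rewrite -sum1_card.
rewrite (partition_big (fun x => <[x]>%G)
           (fun C : {group gT} => (C \subset G) && cyclic C)) /=; last first.
  by move=> x Gx; rewrite cycle_subG Gx cycle_cyclic.
apply: eq_bigr => C /andP[sCG /cyclicP[x defC]].
rewrite defC -orderE totient_gen -sum1_card; apply: eq_bigl => y.
rewrite !inE /generator -defC.
apply/eqP/andP => [defCy|[_ /eqP <-] //].
by rewrite -cycle_subG -defCy sCG; split=> //; apply/eqP/val_inj.
Qed.

Lemma sum_Mprime G H :
    H \proper G ->
  \sum_(Y : {group gT} | (Y \subset G) && ~~ (Y \subset H))
     Mprime Y (Y :&: H)%G = - #|H|%:Z.
Proof.
move=> ltHG; have sHG := proper_sub ltHG.
(* Subgroups X of H outside Y add only zero terms, so the range of X can be made independent of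
   Y. *)
have mobiusE Y : Y \subset G ->
    Mprime Y (Y :&: H)%G
      = \sum_(X : {group gT} | X \subset H) #|X|%:Z * mobius G X Y.
  move=> sYG; rewrite [RHS](bigID (fun X : {group gT} => X \subset Y)) /=.
  rewrite [X in _ + X]big1 ?addr0 => [|X /andP[sXH nsXY]]; last first.
    by rewrite mobius_eq0 ?mulr0 // (subset_trans sXH).
  apply: eq_big => [X|X]; rewrite /= subsetI andbC // => /andP[_ sXY].
  by rewrite (mobius_restrict sYG).
under eq_bigr => Y /andP[sYG _] do rewrite mobiusE //.
(* After the exchange only X = H contributes, with coefficient -1. *)
rewrite exchange_big (bigD1 H) //= -mulr_sumr.
have sum_mu X : X \subset H ->
    \sum_(Y : {group gT} | (Y \subset G) && ~~ (Y \subset H)) mobius G X Y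
      = - (X == H)%:R.
  move=> sXH; have sXG := subset_trans sXH sHG.
  have := sum_mobius_below sXG (subxx G).
  under eq_bigl do rewrite andbb.
  rewrite (bigID (fun Y : {group gT} => Y \subset H)) /= sum_mobius_below //.
  have /negPf-> : X != G.
    by apply: contraTneq ltHG => <-; rewrite properE sXH andbF.
  by move/eqP; rewrite addrC addr_eq0 => /eqP.
rewrite sum_mu // eqxx mulrN1 big1 ?addr0 // => X /andP[sXH neXH].
by rewrite -mulr_sumr sum_mu // (negPf neXH) oppr0 mulr0.
Qed.

End Mobius.

Theorem proposition1p2 (gT : finGroupType) (G N : {group gT}) (p : nat)
    (nNG : (N <| G)%g) (p_pr : prime p) (indexN : #|G : N|%g = p) :
  Mprime G N =
    - (\sum_(C : {group gT} | (C \subset N) && cyclic C) (totient #|C|)%:Z)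
    - \sum_(Y : {group gT} | (Y \proper G) && ~~ (Y \subset N))
        Mprime Y (Y :&: N)%G.
Proof.
have sNG := normal_sub nNG.
have nsGN : ~~ (G \subset N).
  by rewrite -indexg_eq1 indexN neq_ltn prime_gt1 ?orbT.
have ltNG : N \proper G by rewrite properE sNG.
(* Once - |N| is expanded, its term Y = G is the left-hand side and the other terms cancel. *)
rewrite -(big_morph Posz PoszD (erefl _)) sum_totient_cyclic -(sum_Mprime ltNG).
rewrite (bigD1 G) ?subxx //=.
have -> : (G :&: N)%G = N by apply/val_inj/setIidPr.
rewrite -[LHS]addr0 -addrA; congr (_ + _); apply/esym/eqP; rewrite subr_eq0.
apply/eqP/eq_bigl => Y; rewrite properEneq -val_eqE /=.
by rewrite andbC andbA.
Qed.
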